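(* Let $(B,\psi)$ be a finite quantum space such that $\psi$ is a $\delta$-form, and let $X=B\cdot\xi\cdot B$ be a cyclic C*-correspondence over $B$ (with cyclic vector $\xi\in X$). If the map $A\colon B\to B$ defined by $A(x)=\delta^2\langle\xi,x\cdot\xi\rangle_B$ is a quantum adjacency matrix for $(B,\psi)$, then the assignment $x\cdot\xi\cdot y\mapsto x\cdot\epsilon_{(B,\psi,A)}\cdot y$ $(x,y\in B)$ extends to a C*-correspondence isomorphism from $X$ to the quantum edge correspondence $E_{(B,\psi,A)}$.
   Context: A finite quantum space $(B,\psi)$ is a finite-dimensional C*-algebra $B$ with a faithful state $\psi$ that is a $\delta$-form, $\delta>0$: if $m\colon B\otimes B\to B$ is multiplication and $m^*\colon B\to B\otimes B$ is its adjoint with respect to the inner products $\langle x,y\rangle_\psi=\psi(x^*y)$ on $B$ and $\langle\cdot,\cdot\rangle_{\psi\otimes\psi}$ on $B\otimes B$, then $mm^*=\delta^2\,\mathrm{id}_B$. A linear map $A\colon B\to B$ is a quantum adjacency matrix for $(B,\psi)$ if $m(A\otimes A)m^*=\delta^2A$; then $\mathcal{G}=(B,\psi,A)$ is called a (directed) quantum graph. A C*-correspondence over $B$ is a right Hilbert $B$-module $X$ with a $*$-homomorphism $B\to\mathcal{L}(X)$ into the adjointable operators, giving a left action. $X=B\cdot\xi\cdot B$ means $X=\mathrm{span}\{x\cdot\xi\cdot y:x,y\in B\}$. A C*-correspondence isomorphism is a bijective $B$-bimodule map preserving the $B$-valued inner products. $B\otimes_\psi B$ is the C*-correspondence over $B$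 with underlying space $B\otimes B$, actions $x\cdot(a\otimes b)\cdot y=(xa)\otimes(by)$ and inner product $\langle a\otimes b,c\otimes d\rangle_B=b^*\psi(a^*c)d$. The quantum edge indicator of $\mathcal{G}$ is $\epsilon_{\mathcal{G}}=\frac{1}{\delta^2}(\mathrm{id}\otimes A)m^*(1_B)\in B\otimes_\psi B$, and the quantum edge correspondence is the subcorrespondence $E_{\mathcal{G}}=\mathrm{span}\{x\cdot\epsilon_{\mathcal{G}}\cdot y: x,y\in B\}$. *)

(* Defs.v *)
From HB Require Import structures.
From mathcomp Require Import all_boot all_order all_algebra all_field.
From mathcomp Require Import complex.
From mathcomp Require Import all_classical all_reals.
Set Implicit Arguments.
Unset Strict Implicit.
Unset Printing Implicit Defensive.
Import Order.TTheory GRing.Theory Num.Theory.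
Local Open Scope classical_set_scope.
Local Open Scope ring_scope.

Definition lin_span (K : fieldType) (V : lmodType K) (S : set V) : set V :=
  [set v | exists s : seq (K * V),
     (forall p, p \in s -> S p.2) /\ v = \sum_(p <- s) p.1 *: p.2].

Definition norm_complete (R : realType) (V : zmodType) (N : V -> R) : Prop :=
  forall u : nat -> V,
    (forall e : R, 0 < e -> exists n0 : nat, forall m n : nat,
       (n0 <= m)%N -> (n0 <= n)%N -> N (u m - u n) < e) ->
    exists l : V, forall e : R, 0 < e -> exists n0 : nat, forall n : nat,
       (n0 <= n)%N -> N (u n - l) < e.

(* The library's normed modules cannot be joined with falgType, so the
   C*-norm is a field of the mixin. *)
HB.mixin Record Falgebra_isCstar (R : realType) B of Falgebra R[i] B := {
  star : B -> B;
  cnorm : B -> R;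
  star_semilinear : forall (c : R[i]) (x y : B),
    star (c *: x + y) = c^* *: star x + star y;
  starM : forall x y : B, star (x * y) = star y * star x;
  starK : involutive star;
  cnormD : forall x y : B, cnorm (x + y) <= cnorm x + cnorm y;
  cnormZ : forall (c : R[i]) (x : B),
    ((cnorm (c *: x))%:C)%C = `|c| * ((cnorm x)%:C)%C;
  cnorm_eq0 : forall x : B, cnorm x = 0 -> x = 0;
  cnormM : forall x y : B, cnorm (x * y) <= cnorm x * cnorm y;
  cnorm_star : forall x : B, cnorm (star x * x) = cnorm x ^+ 2;
  cnorm_complete : norm_complete cnorm
}.

#[short(type="finCstarAlgType")]
HB.structure Definition FinCstarAlgebra (R : realType) :=
  {B of Falgebra_isCstar R B & Falgebra R[i] B}.

(* V (x) V is modelled by coordinate matrices in the basis vbasis {:V}: with e_i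
   = vbase i, the matrix t stands for the sum of the t i j *: (e_i (x) e_j). The
   universal property is tens_linearl, tens_linearr, tensor_decomp, tlift_linear
   and tlift_tens. *)
Section Tensor.
Context (K : fieldType) (V : vectType K).
Local Notation tensor V := 'M[K]_(\dim {:V}).
Implicit Types (t : tensor V) (a b : V).

Definition vbase (i : 'I_(\dim {:V})) : V := (vbasis {:V})`_i.

Definition tens a b : tensor V :=
  \matrix_(i, j) (coord (vbasis {:V}) i a * coord (vbasis {:V}) j b).

Definition tlift (W : lmodType K) (f : V -> V -> W) t : W :=
  \sum_i \sum_j t i j *: f (vbase i) (vbase j).

Lemma tensE a b i j :
  tens a b i j = coord (vbasis {:V}) i a * coord (vbasis {:V}) j b.
Proof. by rewrite mxE. Qed.

Lemma vbase_decomp a : a = \sum_i coord (vbasis {:V}) i a *: vbase i.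
Proof. by rewrite {1}(coord_vbasis (memvf a)). Qed.

Lemma coord_vbase i j : coord (vbasis {:V}) i (vbase j) = (i == j)%:R.
Proof. by rewrite [LHS]coord_free ?(basis_free (vbasisP _)) // eq_sym. Qed.

Lemma tens_linearl b : linear (tens^~ b).
Proof.
move=> c x y; apply/matrixP=> i j.
by rewrite !mxE linearP mulrDl mulrA.
Qed.

Lemma tens_linearr a : linear (tens a).
Proof.
move=> c x y; apply/matrixP=> i j.
by rewrite !mxE linearP mulrDr mulrCA.
Qed.

Lemma tens_vbase i j : tens (vbase i) (vbase j) = delta_mx i j.
Proof.
apply/matrixP=> k l; rewrite tensE !coord_vbase mxE.
by rewrite -natrM mulnb.
Qed.

Lemma tensor_decomp t : t = \sum_i \sum_j t i j *: tens (vbase i) (vbase j).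
Proof.
rewrite [LHS]matrix_sum_delta; apply: eq_bigr => i _.
by apply: eq_bigr => j _; rewrite tens_vbase.
Qed.

Lemma tlift_linear (W : lmodType K) (f : V -> V -> W) : linear (tlift f).
Proof.
move=> c s t; rewrite /tlift scaler_sumr -big_split; apply: eq_bigr => i _ /=.
rewrite scaler_sumr -big_split; apply: eq_bigr => j _ /=.
by rewrite !mxE scalerDl scalerA.
Qed.

Lemma tlift_tens (W : lmodType K) (f : V -> V -> W) a b :
  (forall y, linear (f^~ y)) -> (forall x, linear (f x)) ->
  tlift f (tens a b) = f a b.
Proof.
move=> fl fr.
have suml x (u : 'I_(\dim {:V}) -> K) (e : 'I_(\dim {:V}) -> V) :
    f (\sum_i u i *: e i) x = \sum_i u i *: f (e i) x.
  pose g : V -> W := f^~ x.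
  have gl : linear g by exact: fl.
  pose G := GRing.isLinear.Build _ _ _ _ g gl.
  pose h : {linear V -> W} := HB.pack g G.
  have -> : f (\sum_i u i *: e i) x = h (\sum_i u i *: e i) by [].
  by rewrite linear_sum; apply: eq_bigr => i _; rewrite linearZ.
have sumr x (u : 'I_(\dim {:V}) -> K) (e : 'I_(\dim {:V}) -> V) :
    f x (\sum_i u i *: e i) = \sum_i u i *: f x (e i).
  pose G := GRing.isLinear.Build _ _ _ _ (f x) (fr x).
  pose h : {linear V -> W} := HB.pack (f x) G.
  have -> : f x (\sum_i u i *: e i) = h (\sum_i u i *: e i) by [].
  by rewrite linear_sum; apply: eq_bigr => i _; rewrite linearZ.
rewrite [in RHS](vbase_decomp a) suml /tlift; apply: eq_bigr => i _.
rewrite [in RHS](vbase_decomp b) sumr scaler_sumr; apply: eq_bigr => j _.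
by rewrite tensE scalerA.
Qed.

End Tensor.

Section QuantumSpace.
Context (R : realType) (B : finCstarAlgType R).
Local Notation tensor V := 'M[R[i]]_(\dim {:V}).
Implicit Types (psi : {scalar B}) (A : B -> B) (x y : B).

(* The sesquilinear extension of
   (a (x) b, c (x) d) |-> f a b c d, conjugate-linear on the left. *)
Definition tsesq (W : lmodType R[i]) (f : B -> B -> B -> B -> W)
    (t s : tensor B) : W :=
  \sum_i \sum_j \sum_k \sum_l
    ((t i j)^* * s k l) *: f (vbase i) (vbase j) (vbase k) (vbase l).

Definition mult : tensor B -> B := tlift (fun a b => a * b).

Definition tensor_map (F G : B -> B) : tensor B -> tensor B :=
  tlift (fun a b => tens (F a) (G b)).

Definition tensor_inner psi : tensor B -> tensor B -> R[i] :=
  @tsesq R[i]^o (fun a b c d => psi (star a * c) * psi (star b * d)).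

Definition faithful_state psi : Prop :=
  [/\ forall x, 0 <= psi (star x * x), psi 1 = 1
    & forall x, psi (star x * x) = 0 -> x = 0].

(* m^*, the adjoint of mult: the vector representing s |-> <x, m s>_psi. It
   exists and is unique when psi is a faithful state, see comult_adjoint and
   tensor_inner_nondeg; 0 is only a default value. *)
Definition comult psi x : tensor B :=
  xget 0 [set t | forall s, tensor_inner psi t s = psi (star x * mult s)].

Lemma semilinear_sum (U W : lmodType R[i]) (I : Type) (r : seq I) (g : U -> W)
    (u : I -> R[i]) (e : I -> U) :
  (forall c (v w : U), g (c *: v + w) = c^* *: g v + g w) ->
  g (\sum_(i <- r) u i *: e i) = \sum_(i <- r) (u i)^* *: g (e i).
Proof.
move=> gP; have g0 : g 0 = 0.
  have := gP 1 0 0; rewrite conjC1 !scale1r addr0 -[LHS]addr0.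
  by move/addrI.
by elim/big_rec2: _ => [//|i y1 y2 _ <-]; rewrite gP.
Qed.

Lemma lin_sum (U W : lmodType R[i]) (I : Type) (r : seq I) (g : U -> W)
    (u : I -> R[i]) (e : I -> U) :
  linear g -> g (\sum_(i <- r) u i *: e i) = \sum_(i <- r) u i *: g (e i).
Proof.
move=> gP; have g0 : g 0 = 0.
  have := gP 1 0 0; rewrite !scale1r addr0 -[LHS]addr0.
  by move/addrI.
by elim/big_rec2: _ => [//|i y1 y2 _ <-]; rewrite gP.
Qed.

Lemma tsesq_tensr (W : lmodType R[i]) (f : B -> B -> B -> B -> W) t c d :
  (forall a b d, linear (fun c => f a b c d)) ->
  (forall a b c, linear (f a b c)) ->
  tsesq f t (tens c d) =
  \sum_i \sum_j (t i j)^* *: f (vbase i) (vbase j) c d.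
Proof.
move=> f3 f4; apply: eq_bigr => i _; apply: eq_bigr => j _.
rewrite [in RHS](vbase_decomp c) (@lin_sum _ _ _ _ (fun c => f _ _ c _)) //.
rewrite scaler_sumr; apply: eq_bigr => k _.
rewrite [in RHS](vbase_decomp d) lin_sum // !scaler_sumr.
by apply: eq_bigr => l _; rewrite tensE !scalerA mulrA.
Qed.

Lemma tsesq_tens (W : lmodType R[i]) (f : B -> B -> B -> B -> W) a b c d :
  (forall b c d k x y,
     f (k *: x + y) b c d = k^* *: f x b c d + f y b c d) ->
  (forall a c d k x y,
     f a (k *: x + y) c d = k^* *: f a x c d + f a y c d) ->
  (forall a b d, linear (fun c => f a b c d)) ->
  (forall a b c, linear (f a b c)) ->
  tsesq f (tens a b) (tens c d) = f a b c d.
Proof.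
move=> f1 f2 f3 f4; rewrite tsesq_tensr //.
rewrite [in RHS](vbase_decomp a).
rewrite (@semilinear_sum _ _ _ _ (fun a => f a b c d)) //.
apply: eq_bigr => i _; rewrite [in RHS](vbase_decomp b).
rewrite (@semilinear_sum _ _ _ _ (fun b => f _ b c d)) // scaler_sumr.
by apply: eq_bigr => j _; rewrite tensE rmorphM scalerA.
Qed.

Lemma tensor_inner_tens psi a b c d :
  tensor_inner psi (tens a b) (tens c d) = psi (star a * c) * psi (star b * d).
Proof.
rewrite /tensor_inner tsesq_tens //
  => [b' c' d' k x y|a' c' d' k x y|a' b' d'|a' b' c'].
- by rewrite star_semilinear mulrDl -scalerAl linearP mulrDl -mulrA.
- rewrite star_semilinear mulrDl -scalerAl linearP mulrDr.
  by rewrite mulrCA.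
- by move=> k x y; rewrite mulrDr -scalerAr linearP mulrDl -mulrA.
- by move=> k x y; rewrite mulrDr -scalerAr linearP mulrDr mulrCA.
Qed.

Lemma tensor_inner_nondeg psi t :
  faithful_state psi -> (forall s, tensor_inner psi t s = 0) -> t = 0.
Proof.
move=> [_ _ psi_eq0] t0.
have inj0 v : (forall c, psi (star v * c) = 0) -> v = 0.
  by move=> v0; apply: psi_eq0; apply: v0.
have free0 (u : 'I_(\dim {:B}) -> R[i]) :
    \sum_i u i *: vbase i = 0 -> forall i, u i = 0.
  by move=> u0; apply/freeP: u0; apply: basis_free (vbasisP _).
have row0 i (c : B) : \sum_k t k i * (psi (star (vbase k) * c))^* = 0.
  move: i; apply: free0; apply: inj0 => d.
  rewrite (@semilinear_sum B R[i]^o _ _ (fun v => psi (star v * d)));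
    last first.
    by move=> k x y; rewrite star_semilinear mulrDl -scalerAl linearP.
  have := t0 (tens c d); rewrite /tensor_inner tsesq_tensr.
  - rewrite exchange_big => h; rewrite -[RHS]h; apply: eq_bigr => j _.
    rewrite rmorph_sum scaler_suml; apply: eq_bigr => i _.
    by rewrite rmorphM /= conjCK /GRing.scale /= mulrA.
  - by move=> a b d' k x y; rewrite mulrDr -scalerAr linearP mulrDl -mulrA.
  - by move=> a b c' k x y; rewrite mulrDr -scalerAr linearP mulrDr mulrCA.
apply/matrixP=> i j; rewrite mxE; move: i; apply: free0; apply: inj0 => c.
rewrite (@semilinear_sum B R[i]^o _ _ (fun v => psi (star v * c))); last first.
  by move=> k x y; rewrite star_semilinear mulrDl -scalerAl linearP.
apply: (can_inj (@conjCK _)); rewrite conjC0 -[RHS](row0 j c) rmorph_sum.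
by apply: eq_bigr => k _; rewrite rmorphM /= conjCK.
Qed.

Lemma comult_adjoint psi x s :
  faithful_state psi ->
  tensor_inner psi (comult psi x) s = psi (star x * mult s).
Proof.
move=> hpsi; rewrite /comult.
set P := (X in xget 0 X).
suff exP : exists t, P t by have := xgetPex 0 exP; apply.
pose L (u : tensor B) : tensor B := \matrix_(k, l) \sum_i \sum_j
  u i j * (psi (star (vbase i) * vbase k) * psi (star (vbase j) * vbase l)).
have Llin : linear L.
  move=> c u v; apply/matrixP=> k l; rewrite !mxE mulr_sumr -big_split.
  apply: eq_bigr => i _ /=; rewrite mulr_sumr -big_split.
  by apply: eq_bigr => j _ /=; rewrite !mxE mulrDl mulrA.
pose Lm := GRing.isLinear.Build _ _ _ _ L Llin.
pose Ll : {linear tensor B -> tensor B} := HB.pack L Lm.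
have LE u s' : tensor_inner psi (map_mx Num.conj u) s' =
    \sum_k \sum_l s' k l * L u k l.
  rewrite /tensor_inner /tsesq.
  under eq_bigr do rewrite exchange_big.
  rewrite exchange_big; apply: eq_bigr => k _ /=.
  under eq_bigr do rewrite exchange_big.
  rewrite exchange_big; apply: eq_bigr => l _ /=.
  rewrite mxE mulr_sumr; apply: eq_bigr => i _; rewrite mulr_sumr.
  apply: eq_bigr => j _; rewrite mxE conjCK /GRing.scale /=.
  by rewrite mulrA (mulrC (s' k l)).
have Lker : lker (linfun Ll) == 0%VS.
  apply/lker0P => u v; rewrite !lfunE /= => Luv; apply/eqP; rewrite -subr_eq0.
  have : L (u - v) = 0 by rewrite -[L]/(Ll : _ -> _) linearB /= Luv subrr.
  move=> L0; apply/eqP; apply/matrixP => i j.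
  have /matrixP/(_ i j) : map_mx Num.conj (u - v) = 0.
    apply: (tensor_inner_nondeg hpsi) => s'; rewrite LE L0 /=.
    by apply: big1 => k _; apply: big1 => l _;
      rewrite [(0 : tensor B) k l]mxE mulr0.
  by rewrite mxE ![(0 : tensor B) i j]mxE => /(congr1 Num.conj);
    rewrite conjCK conjC0.
pose F : tensor B := \matrix_(k, l) psi (star x * (vbase k * vbase l)).
pose u := ((linfun Ll)^-1)%VF F.
have Lu : L u = F by have := lker0_lfunVK Lker F; rewrite lfunE.
exists (map_mx Num.conj u) => s'; rewrite LE Lu /mult /tlift.
rewrite mulr_sumr linear_sum; apply: eq_bigr => k _.
rewrite mulr_sumr linear_sum; apply: eq_bigr => l _.
by rewrite mxE -scalerAr linearZ.
Qed.

Record finite_quantum_space psi (delta : R) : Prop := FiniteQuantumSpace {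
  fqs_state : faithful_state psi;
  fqs_delta_gt0 : 0 < delta;
  fqs_delta_form :
    forall x, mult (comult psi x) = ((delta ^+ 2)%:C)%C *: x }.

Record quantum_adjacency psi (delta : R) A : Prop := QuantumAdjacency {
  qadj_linear : linear A;
  qadj_schur : forall x,
    mult (tensor_map A A (comult psi x)) = ((delta ^+ 2)%:C)%C *: A x }.

(* The carrier and operations of a C*-correspondence over B, without axioms. *)
Record corr_data := CorrData {
  corr_sort :> lmodType R[i];
  lact : B -> corr_sort -> corr_sort;
  ract : corr_sort -> B -> corr_sort;
  inner : corr_sort -> corr_sort -> B }.

(* Positivity in B is "of the form c^* c". Adjointable maps on a Hilbert module
   are automatically linear and B-linear, so lact_adj says that lact takes its
   values in L(X) and preserves adjoints. The left action need not be unital. *)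
Record is_correspondence (X : corr_data) : Prop := IsCorrespondence {
  ract_linearl : forall b, linear (fun v : X => ract v b);
  ract_linearr : forall v : X, linear (ract v);
  ractM : forall (v : X) a b, ract v (a * b) = ract (ract v a) b;
  ract1 : forall v : X, ract v 1 = v;
  inner_linearr : forall v : X, linear (inner v);
  inner_ract : forall (v w : X) b, inner v (ract w b) = inner v w * b;
  inner_star : forall v w : X, star (inner v w) = inner w v;
  inner_ge0 : forall v : X, exists c, inner v v = star c * c;
  inner_eq0 : forall v : X, inner v v = 0 -> v = 0;
  inner_complete :
    norm_complete (fun v : X => Num.sqrt (cnorm (inner v v)));
  lact_linearl : forall v : X, linear (fun b => lact b v);
  lactM : forall a b (v : X), lact (a * b) v = lact a (lact b v);
  lact_adj : forall b (v w : X),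
    inner (lact b v) w = inner v (lact (star b) w) }.

Record correspondence := Correspondence {
  corr_base :> corr_data;
  corr_axioms : is_correspondence corr_base }.

Definition cyclic_span (X : corr_data) (xi : X) : set X :=
  lin_span [set v | exists x y, v = ract (lact x xi) y].

Definition cyclic_vector (X : corr_data) (xi : X) : Prop :=
  cyclic_span xi = [set: X].

Record corr_iso (X Y : corr_data) (E : set Y) (Phi : X -> Y) : Prop := CorrIso {
  iso_linear : linear Phi;
  iso_lact : forall b v, Phi (lact b v) = lact b (Phi v);
  iso_ract : forall v b, Phi (ract v b) = ract (Phi v) b;
  iso_inner : forall v w, inner (Phi v) (Phi w) = inner v w;
  iso_bij : set_bij [set: X] E Phi }.

(* B (x)_psi B *)
Definition tensor_corr psi : corr_data := {|
  corr_sort := tensor B;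
  lact := fun x => tensor_map (fun a => x * a) id;
  ract := fun t y => tensor_map id (fun b => b * y) t;
  inner := tsesq (fun a b c d => psi (star a * c) *: (star b * d)) |}.

Lemma inner_tens psi a b c d :
  @inner (tensor_corr psi) (tens a b) (tens c d) =
  star b * (psi (star a * c) *: d).
Proof.
rewrite -scalerAr /= tsesq_tens //
  => [b' c' d' k x y|a' c' d' k x y|a' b' d'|a' b' c'].
- by rewrite star_semilinear mulrDl -scalerAl linearP scalerDl scalerA.
- rewrite star_semilinear mulrDl -scalerAl scalerDr !scalerA.
  by rewrite [_ * k^*]mulrC.
- by move=> k x y; rewrite mulrDr -scalerAr linearP scalerDl scalerA.
- by move=> k x y; rewrite mulrDr -scalerAr scalerDr !scalerA [_ * k]mulrC.
Qed.

Definition edge_indicator psi (delta : R) A : tensor_corr psi :=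
  ((delta ^- 2)%:C)%C *: tensor_map id A (comult psi 1).

Definition edge_correspondence psi (delta : R) A : set (tensor_corr psi) :=
  cyclic_span (edge_indicator psi delta A).

Definition corr_map (X : corr_data) (delta : R) (xi : X) : B -> B :=
  fun x => ((delta ^+ 2)%:C)%C *: inner xi (lact x xi).

End QuantumSpace.

Arguments edge_correspondence {R B} psi delta A.

(* Main.v *)
(* Write m^*(1) = sum_k e_k (x) f_k. A tensor t is determined by its slices
   (psi (x) id)((a (x) 1) t), and those of m^*(x) are the elements a x; hence
   x.m^*(1) = m^*(x) = m^*(1).x. An isomorphism must send v to the tensor with
   slices <xi, a.v>, which is Phi v = sum_k e_k (x) <xi, f_k.v>. This formula is
   visibly a bimodule map with Phi xi = eps, so nothing has to be checked about
   well-definedness on the generators x.xi.y. Moreover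
     <Phi v, Phi w> = sum_k <v, e_k.xi> <xi, f_k.w>,
   and for generators v = x.xi.y and w = x'.xi.y' this is
     delta^-4 y^* m(A (x) A)m^*(x^* x') y' = delta^-2 y^* A(x^* x') y' = <v, w>
   by the quantum adjacency identity. *)
Require Import Defs.
From mathcomp Require Import all_boot all_order all_algebra all_field.
From mathcomp Require Import complex.
From mathcomp Require Import all_classical all_reals.
From mathcomp Require Import ring.
Import Order.TTheory GRing.Theory Num.Theory.
Local Open Scope ring_scope.

Set Implicit Arguments.
Unset Strict Implicit.
Unset Printing Implicit Defensive.

(** * Linear maps given as plain functions *)

Section Linear.
Context (K : fieldType) (V : vectType K).

Lemma linear0_fun (U W : lmodType K) (g : U -> W) : linear g -> g 0 = 0.
Proof.
move=> gP; have := gP 1 0 0; rewrite !scale1r addr0 -[LHS]addr0.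
by move/addrI.
Qed.

Lemma linearD_fun (U W : lmodType K) (g : U -> W) u v :
  linear g -> g (u + v) = g u + g v.
Proof. by move=> gP; have := gP 1 u v; rewrite !scale1r. Qed.

Lemma linearZ_fun (U W : lmodType K) (g : U -> W) c u :
  linear g -> g (c *: u) = c *: g u.
Proof. by move=> gP; have := gP c u 0; rewrite (linear0_fun gP) !addr0. Qed.

Lemma linear_sum_fun (U W : lmodType K) (g : U -> W) I (r : seq I) F :
  linear g -> g (\sum_(i <- r) F i) = \sum_(i <- r) g (F i).
Proof.
move=> gP; apply: big_morph; last exact: linear0_fun.
by move=> u v; exact: linearD_fun.
Qed.

Lemma linear_tlift (U W : lmodType K) (g : U -> W) (f : V -> V -> U) t :
  linear g -> g (tlift f t) = tlift (fun a b => g (f a b)) t.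
Proof.
move=> gP; rewrite /tlift linear_sum_fun //; apply: eq_bigr => i _.
by rewrite linear_sum_fun //; apply: eq_bigr => j _; rewrite linearZ_fun.
Qed.

Lemma eq_tlift (W : lmodType K) (f g : V -> V -> W) t :
  (forall a b, f a b = g a b) -> tlift f t = tlift g t.
Proof.
by move=> fg; apply: eq_bigr => i _; apply: eq_bigr => j _; rewrite fg.
Qed.

End Linear.

(** * The involution, the state, and slices of tensors *)

Section State.
Context (R : realType) (B : finCstarAlgType R) (psi : {scalar B}).
Hypothesis hpsi : faithful_state psi.
Local Notation tensor := 'M[R[i]]_(\dim {:B}).
Implicit Types (a b x y : B) (t s : tensor).

Lemma star1 : star (1 : B) = 1.
Proof. by rewrite -[LHS]mulr1 -[X in _ * X](@starK R B) -starM mulr1 starK. Qed.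

Lemma starD x y : star (x + y) = star x + star y.
Proof. by have := star_semilinear 1 x y; rewrite conjC1 !scale1r. Qed.

Lemma star0 : star (0 : B) = 0.
Proof. by have := starD 0 0; rewrite addr0 -[LHS]addr0 => /addrI. Qed.

Lemma starZ c x : star (c *: x) = c^* *: star x.
Proof. by have := star_semilinear c x 0; rewrite star0 !addr0. Qed.

Lemma starN x : star (- x) = - star x.
Proof. by rewrite -scaleN1r starZ rmorphN1 scaleN1r. Qed.

(** Positivity makes [psi (star y) + psi y] real for every [y], by expanding
    [psi (star (1 + y) * (1 + y))]. Taking [y = x] and [y = 'i *: x] shows that
    [psi x + psi (star x)] is real and [psi x - psi (star x)] imaginary. *)
Lemma state_star x : psi (star x) = (psi x)^*.
Proof.
have [psi_ge0 psi1 _] := hpsi.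
have real_sum y : (psi (star y) + psi y)^* = psi (star y) + psi y.
  apply/CrealP.
  have -> : psi (star y) + psi y
      = psi (star (1 + y) * (1 + y)) - psi (star y * y) - 1.
    by rewrite starD star1 mulrDl !mulrDr !mul1r mulr1 !linearD /= psi1; ring.
  by rewrite !rpredB ?rpred1 // ger0_real.
have h1 := real_sum x.
have := real_sum ('i *: x).
rewrite starZ conjCi !linearZ /= mulNr addrC -mulrBr rmorphM /= conjCi mulNr.
rewrite -mulrN => /(mulfI (neq0Ci _)) h2.
have two0 : (2 : R[i]) != 0 by rewrite pnatr_eq0.
apply: (mulfI two0); move: h1 h2; rewrite rmorphD rmorphB /=.
move: (psi x) (psi (star x)) => p q h1 h2.
rewrite (_ : 2 * q = (q + p) - (p - q)); last by ring.
by rewrite -h1 -h2; ring.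
Qed.

(** The functional [psi (a * _)] applied to the first leg of the tensor. *)
Definition slice a : tensor -> B := tlift (fun e f => psi (a * e) *: f).

Lemma slice_linear a : linear (slice a).
Proof. exact: tlift_linear. Qed.

Lemma slice_linearl t : linear (slice^~ t).
Proof.
move=> c a b; rewrite /slice /tlift scaler_sumr -big_split.
apply: eq_bigr => i _; rewrite scaler_sumr -big_split; apply: eq_bigr => j _ /=.
rewrite mulrDl -scalerAl linearP scalerDl scalerDr !scalerA.
by congr (_ *: _ + _); rewrite mulrCA mulrA.
Qed.

Lemma slice_tens a x y : slice a (tens x y) = psi (a * x) *: y.
Proof.
apply: (tlift_tens (f := fun e f => psi (a * e) *: f)) => u c v w.
- by rewrite mulrDr -scalerAr linearP scalerDl scalerA.
- by rewrite scalerDr !scalerA mulrC.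
Qed.

Lemma slice_tlift a (s : B -> B -> tensor) t :
  slice a (tlift s t) = tlift (fun e f => slice a (s e f)) t.
Proof. exact/linear_tlift/slice_linear. Qed.

(** A slice consumes the first leg only, so it commutes with linear maps on the second. *)
Lemma slice_tlift_tens a (F : B -> B) t : linear F ->
  slice a (tlift (fun e f => tens e (F f)) t) = F (slice a t).
Proof.
move=> Flin; rewrite slice_tlift (linear_tlift _ _ Flin).
by apply: eq_tlift => e f; rewrite slice_tens linearZ_fun.
Qed.

Lemma state_nondeg u v :
  (forall b, psi (star u * b) = psi (star v * b)) -> u = v.
Proof.
have [_ _ psi_eq0] := hpsi.
move=> uv; apply/eqP; rewrite -subr_eq0; apply/eqP/psi_eq0.
by rewrite starD starN mulrBl linearB /= uv subrr.
Qed.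

(** By [state_star], [psi (star e * c)] is the conjugate of [psi (star c * e)], so the left argument
    enters the inner product only through its slices. *)
Lemma inner_slice t s :
  @inner R B (tensor_corr psi) t s =
  tlift (fun c d => star (slice (star c) t) * d) s.
Proof.
rewrite /= /tsesq /tlift.
under eq_bigr do rewrite exchange_big.
rewrite exchange_big; apply: eq_bigr => k _ /=.
under eq_bigr do rewrite exchange_big.
rewrite exchange_big; apply: eq_bigr => l _ /=.
rewrite /slice /tlift (big_morph _ starD star0) mulr_suml scaler_sumr.
apply: eq_bigr => i _; rewrite (big_morph _ starD star0) mulr_suml scaler_sumr.
apply: eq_bigr => j _; rewrite !starZ -state_star starM starK -!scalerAl.
by rewrite scalerA [in RHS]scalerA scalerA; congr (_ *: _); ring.
Qed.

Lemma state_inner t s :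
  psi (@inner R B (tensor_corr psi) t s) = tensor_inner psi t s.
Proof.
rewrite /= /tensor_inner /tsesq.
do 4! [rewrite linear_sum; apply: eq_bigr => ? _].
by rewrite linearZ /= linearZ.
Qed.

(** By [inner_slice], a tensor with zero slices is orthogonal to everything, and the scalar inner
    product is nondegenerate. *)
Lemma slice_inj t s : (forall a, slice a t = slice a s) -> t = s.
Proof.
move=> ts; apply/eqP; rewrite -subr_eq0; apply/eqP.
apply: (tensor_inner_nondeg hpsi) => r.
rewrite -state_inner inner_slice (_ : tlift _ r = 0) ?linear0 //.
apply: big1 => i _; apply: big1 => j _.
have -> : t - s = -1 *: s + t by rewrite scaleN1r addrC.
by rewrite slice_linear ts scaleN1r addNr star0 mul0r scaler0.
Qed.

(** Pairing [comult psi x] with [tens (star a) b] gives [psi (star (slice a (comult psi x)) * b)] by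
    [inner_slice] and [psi (star (a * x) * b)] by adjointness; [b] is arbitrary and [psi]
    faithful. *)
Lemma slice_comult a x : slice a (comult psi x) = a * x.
Proof.
apply: state_nondeg => b.
have := comult_adjoint x (tens (star a) b) hpsi.
rewrite -state_inner inner_slice tlift_tens.
- rewrite starK => ->; rewrite /mult tlift_tens ?starM ?mulrA //.
  + by move=> y c u v; rewrite mulrDl scalerAl.
  + by move=> y c u v; rewrite mulrDr scalerAr.
- move=> y c u v /=; rewrite star_semilinear slice_linearl star_semilinear.
  by rewrite conjCK mulrDl scalerAl.
- by move=> y c u v; rewrite mulrDr scalerAr.
Qed.

Lemma slice_lact a x t :
  slice a (@lact R B (tensor_corr psi) x t) = slice (a * x) t.
Proof.
by rewrite /= slice_tlift; apply: eq_tlift => e f; rewrite slice_tens mulrA.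
Qed.

Lemma slice_ract a y t :
  slice a (@ract R B (tensor_corr psi) t y) = slice a t * y.
Proof.
apply: (@slice_tlift_tens a (fun f => f * y)) => c u v.
by rewrite mulrDl scalerAl.
Qed.

(** [tensor_corr psi] is a bare [corr_data], so this has to come from the slice formula instead of
    the correspondence axioms. *)
Lemma tensor_inner_semilinearl (c : R[i]) (t t' s : tensor_corr psi) :
  inner (c *: t + t') s = c^* *: inner t s + inner t' s.
Proof.
rewrite !inner_slice /tlift scaler_sumr -big_split; apply: eq_bigr => i _ /=.
rewrite scaler_sumr -big_split; apply: eq_bigr => j _ /=.
rewrite slice_linear star_semilinear mulrDl -scalerAl scalerDr !scalerA.
by rewrite mulrC.
Qed.

End State.

(** * Consequences of the correspondence axioms *)

Section Correspondence.
Context (R : realType) (B : finCstarAlgType R) (X : correspondence B).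
Implicit Types (x y : B) (u v w : X).
Let XP := corr_axioms X.

Lemma corr_inner_inj v w : (forall z, inner z v = inner z w) -> v = w.
Proof.
move=> vw; apply/eqP; rewrite -subr_eq0; apply/eqP/(inner_eq0 XP).
by rewrite -scaleN1r addrC (inner_linearr XP) vw !scaleN1r addNr.
Qed.

(** Adjointability: tested against any [z], the action of [x] moves to the other side as
    [star x]. *)
Lemma lact_linear x : linear (@lact R B X x).
Proof.
move=> c v w; apply: corr_inner_inj => z.
rewrite -[x]starK -(lact_adj XP) !(inner_linearr XP).
by rewrite -!(lact_adj XP).
Qed.

Lemma lact_ract x v y : lact x (ract v y) = ract (lact x v) y.
Proof.
apply: corr_inner_inj => z.
by rewrite -[x]starK -(lact_adj XP) !(inner_ract XP) -(lact_adj XP).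
Qed.

Lemma inner_ractl v w y : inner (ract v y) w = star y * inner v w.
Proof. by rewrite -(inner_star XP) (inner_ract XP) starM (inner_star XP). Qed.

Lemma inner_semilinearl (c : R[i]) u v w :
  inner (c *: u + v) w = c^* *: inner u w + inner v w.
Proof.
by rewrite -(inner_star XP) (inner_linearr XP) star_semilinear !(inner_star XP).
Qed.

Lemma cyclic_ind (xi : X) (P : X -> Prop) :
  cyclic_vector xi -> P 0 ->
  (forall (c : R[i]) v w, P v -> P w -> P (c *: v + w)) ->
  (forall x y, P (ract (lact x xi) y)) -> forall v, P v.
Proof.
move=> hxi P0 PD Pg v; have : cyclic_span xi v by rewrite hxi.
case=> s [sP ->]; rewrite big_seq; elim/big_rec: _ => [//|p w ps Pw].
by apply: PD => //; have [x [y ->]] := sP _ ps.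
Qed.

End Correspondence.

(** * The bimodule map into the tensor correspondence and its isometry *)

Section EdgeMap.
Context (R : realType) (B : finCstarAlgType R) (psi : {scalar B}) (delta : R).
Hypothesis hpsi : finite_quantum_space psi delta.
Context (X : correspondence B) (xi : X).
Hypothesis hA : quantum_adjacency psi delta (corr_map delta xi).
Local Notation A := (corr_map delta xi).
Let XP := corr_axioms X.
Let psiP := fqs_state hpsi.

Definition edge_map (v : X) : tensor_corr psi :=
  tlift (fun e f => tens e (inner xi (lact f v))) (comult psi 1).

Lemma inner_lact_linear (v : X) : linear (fun b => inner xi (lact b v)).
Proof. by move=> c a b; rewrite (lact_linearl XP) (inner_linearr XP). Qed.

(** The slice of [comult psi 1] at [a] is [a] itself. With [slice_inj] this characterises
    [edge_map v], and the bimodule properties follow by comparing slices. *)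
Lemma slice_edge_map a v : slice psi a (edge_map v) = inner xi (lact a v).
Proof.
rewrite /edge_map (slice_tlift_tens _ _ _ (inner_lact_linear v)).
by rewrite slice_comult ?mulr1.
Qed.

Lemma edge_map_linear : linear edge_map.
Proof.
move=> c v w; apply: (slice_inj psiP) => a.
by rewrite slice_linear !slice_edge_map lact_linear (inner_linearr XP).
Qed.

Lemma edge_map_lact x v : edge_map (lact x v) = lact x (edge_map v).
Proof.
apply: (slice_inj psiP) => a.
by rewrite slice_lact !slice_edge_map (lactM XP).
Qed.

Lemma edge_map_ract v y : edge_map (ract v y) = ract (edge_map v) y.
Proof.
apply: (slice_inj psiP) => a.
by rewrite slice_ract !slice_edge_map lact_ract (inner_ract XP).
Qed.

Lemma delta_neq0 : ((delta ^+ 2)%:C)%C != 0 :> R[i].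
Proof.
by rewrite fmorph_eq0 expf_neq0 // lt0r_neq0 // (fqs_delta_gt0 hpsi).
Qed.

Lemma edge_map_cyclic : edge_map xi = edge_indicator psi delta A.
Proof.
have Alin := qadj_linear hA.
apply: (slice_inj psiP) => a; rewrite slice_edge_map.
rewrite linearZ_fun; last exact: slice_linear.
rewrite (slice_tlift_tens psi a _ Alin) slice_comult // mulr1 /corr_map.
by rewrite scalerA fmorphV mulVf ?scale1r ?delta_neq0.
Qed.

Lemma inner_edge_map v w : inner (edge_map v) (edge_map w) =
  tlift (fun c d => inner v (lact c xi) * inner xi (lact d w)) (comult psi 1).
Proof.
rewrite inner_slice // [edge_map w]/edge_map (linear_tlift _ _ (tlift_linear _)).
apply: eq_tlift => c d; rewrite tlift_tens.
- by rewrite slice_edge_map (inner_star XP) (lact_adj XP) starK.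
- move=> y k a b /=; rewrite star_semilinear slice_linearl star_semilinear.
  by rewrite conjCK mulrDl scalerAl.
- by move=> y k a b; rewrite mulrDr scalerAr.
Qed.

Lemma inner_edge_map_gen x y x' y' :
  inner (edge_map (ract (lact x xi) y)) (edge_map (ract (lact x' xi) y')) =
  inner (ract (lact x xi) y) (ract (lact x' xi) y').
Proof.
have Alin := qadj_linear hA; have d0 := delta_neq0.
have AE b : inner xi (lact b xi) = ((delta ^+ 2)%:C)%C^-1 *: A b.
  by rewrite /corr_map scalerA mulVf // scale1r.
(* Both sides have slice [a * star x * x'] at every [a]. *)
have cE : comult psi (star x * x') =
    tensor_map (fun c => star x * c) (fun d => d * x') (comult psi 1).
  apply: (slice_inj psiP) => a; rewrite slice_comult // slice_tlift.
  have /(slice_tlift_tens psi (a * star x)) : linear (fun d : B => d * x').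
    by move=> k u v; rewrite mulrDl scalerAl.
  move/(_ (comult psi 1)); rewrite slice_comult // mulr1 mulrA => <-.
  by rewrite slice_tlift; apply: eq_tlift => e f; rewrite !slice_tens mulrA.
have schur : tlift (fun c d => A (star x * c) * A (d * x')) (comult psi 1) =
    ((delta ^+ 2)%:C)%C *: A (star x * x').
  rewrite -(qadj_schur hA) cE /mult /tensor_map.
  rewrite !(linear_tlift _ _ (tlift_linear _)).
  apply: eq_tlift => c d; rewrite !tlift_tens //.
  - by move=> u k v w; rewrite mulrDl scalerAl.
  - by move=> u k v w; rewrite mulrDr scalerAr.
  - by move=> u k v w; rewrite Alin tens_linearl.
  - by move=> u k v w; rewrite Alin tens_linearr.
rewrite inner_edge_map inner_ractl (inner_ract XP) (lact_adj XP) -(lactM XP).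
(* A factor 1, split as [delta ^- 2] times [delta ^+ 2], is inserted on the right to expose the
   right side of [schur]. The two inverse factors left over match the two uses of [AE] on the
   left. *)
rewrite AE -[X in _ = star y * (_ *: X * y')]scale1r -(mulVf d0) -scalerA -schur.
pose g u :=
  star y * (((delta ^+ 2)%:C)%C^-1 *: (((delta ^+ 2)%:C)%C^-1 *: u) * y').
rewrite -[RHS]/(g _) (linear_tlift (g := g)).
  apply: eq_tlift => c d; rewrite inner_ractl (lact_adj XP) -(lactM XP).
  rewrite lact_ract (inner_ract XP) -(lactM XP) !AE /g.
  by rewrite -!(scalerAl, scalerAr) !scalerA !mulrA; congr (_ *: _); ring.
move=> k u v; rewrite /g !scalerDr mulrDl mulrDr; congr (_ + _).
rewrite -!(scalerAl, scalerAr) !scalerA; congr (_ *: _).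
by rewrite mulrCA mulrA mulrAC.
Qed.

Lemma edge_map_isometry v w : cyclic_vector xi ->
  inner (edge_map v) (edge_map w) = inner v w.
Proof.
move=> hxi; have E0 := linear0_fun edge_map_linear.
have in0 (z : X) : inner z 0 = 0 :> B := linear0_fun (inner_linearr XP z).
have in0l (z : X) : inner 0 z = 0 :> B by rewrite -(inner_star XP) in0 star0.
have tin0l (z : tensor_corr psi) : inner (0 : tensor_corr psi) z = 0 :> B.
  have := tensor_inner_semilinearl psiP (-1) 0 0 z.
  by rewrite scaleN1r oppr0 addr0 rmorphN1 scaleN1r addNr.
have tin_lin (z : tensor_corr psi) : linear (inner z).
  by move=> c t s; rewrite !inner_slice // tlift_linear.
(* Semilinearity reduces [v] to a generator; linearity then does the same for [w]. *)
move: v; apply: (cyclic_ind hxi); first by rewrite E0 tin0l in0l.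
  move=> c u v uE vE; rewrite edge_map_linear tensor_inner_semilinearl //.
  by rewrite inner_semilinearl uE vE.
move=> x y; move: w; apply: (cyclic_ind hxi).
- by rewrite E0 (linear0_fun (tin_lin _)) in0.
- by move=> c u v uE vE; rewrite edge_map_linear tin_lin (inner_linearr XP) uE vE.
- by move=> x' y'; rewrite inner_edge_map_gen.
Qed.

End EdgeMap.

(** * The isomorphism onto the edge correspondence *)

Theorem proposition2p7 (R : realType) (B : finCstarAlgType R)
    (psi : {scalar B}) (delta : R)
    (hpsi : finite_quantum_space psi delta)
    (X : correspondence B) (xi : X) (hxi : cyclic_vector xi)
    (hA : quantum_adjacency psi delta (corr_map delta xi)) :
  exists Phi : X -> tensor_corr psi,
    (forall x y : B, Phi (ract (lact x xi) y) =
       ract (lact x (edge_indicator psi delta (corr_map delta xi))) y) /\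
    corr_iso (edge_correspondence psi delta (corr_map delta xi)) Phi.
Proof.
have XP := corr_axioms X.
have genE x y : edge_map psi xi (ract (lact x xi) y) =
    ract (lact x (edge_indicator psi delta (corr_map delta xi))) y.
  by rewrite (edge_map_ract hpsi) (edge_map_lact hpsi) (edge_map_cyclic hpsi hA).
have Elin := edge_map_linear hpsi xi.
exists (edge_map psi xi); split=> //; split=> //.
- exact: (edge_map_lact hpsi).
- exact: (edge_map_ract hpsi).
- by move=> v w; exact: (edge_map_isometry hpsi hA).
split.
(* The image lies in the span: a decomposition of [v] into generators is carried over termwise. *)
- move=> v _; have : cyclic_span xi v by rewrite hxi.
  case=> s [sP ->].
  exists [seq (p.1, edge_map psi xi p.2) | p <- s]; split.
    move=> _ /mapP [p ps ->] /=; have [x [y ->]] := sP _ ps.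
    by exists x, y.
  rewrite big_map linear_sum_fun //; apply: eq_bigr => p _.
  by rewrite linearZ_fun.
(* Injectivity from isometry: [inner z v] depends only on the images of [z] and [v]. *)
- move=> v w _ _ vw; apply: corr_inner_inj => z.
  by rewrite -!(edge_map_isometry hpsi hA) // vw.
(* Surjectivity: a preimage is built up along the sum, one generator at a time. *)
- move=> t [s [sP ->]]; rewrite big_seq.
  elim/big_rec: _ => [|p _ ps [v _ <-]].
    by exists 0 => //; exact: linear0_fun.
  have [x [y ->]] := sP _ ps.
  by exists (p.1 *: ract (lact x xi) y + v) => //; rewrite Elin genE.
Qed.
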